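(* Let $d\ge1$, $t\ge1$ be integers, $\epsilon\in(0,1)$, and let $\mu_t$ be a finite Borel measure on $\mathbb S^d$ satisfying the Marcinkiewicz–Zygmund inequalities of order $t$ with constants $0<a\le A$: \[ a\|f\|_{L^2(\mathbb S^d)}^2\le\int_{\mathbb S^d}|f|^2\,d\mu_t\le A\|f\|_{L^2(\mathbb S^d)}^2\quad\text{for all }f\in\Pi_t . \] Define \[ V_d=\frac{A/a}{1-\epsilon}\,\pi\,M_d\,d^2\,2^{\frac d2+6}\Big(\frac{\sqrt d}{e}\Big)^d,\qquad M_d=\frac{2e}{\pi}\Big(2+\sqrt{\tfrac{d^2}{2}-d+1}\Big). \] Then for every $R$ with $V_d/t\le R\le\pi$ and every $z\in\mathbb S^d$, \[ \mu_t\big(B_R(z)\big)\ge\frac{a\,\epsilon}{\dim\Pi_t}. \]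
   Context: $\mathbb S^d\subset\mathbb R^{d+1}$ is the unit sphere with normalized surface measure (total mass $1$), and $L^2$ norms are with respect to it. $B_R(z)=\{y\in\mathbb S^d:z\cdot y\ge\cos R\}$. $\Pi_t$ is the space of restrictions to $\mathbb S^d$ of polynomials in $d+1$ variables of degree at most $t$, $\dim\Pi_t=\binom{d+t}{t}+\binom{d+t-1}{t-1}$. *)

(* Defs.v *)
From HB Require Import structures.
From mathcomp Require Import all_boot all_order all_algebra.
From mathcomp Require Import all_classical all_reals all_analysis.
Set Implicit Arguments. Unset Strict Implicit. Unset Printing Implicit Defensive.
Import Order.TTheory GRing.Theory Num.Theory.
Import numFieldNormedType.Exports.
Local Open Scope classical_set_scope.
Local Open Scope ring_scope.

Definition Rsp (R : realType) (d : nat) :=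
  g_sigma_algebraType (@open ('rV[R]_(d.+1))).

(* Euclidean inner product (NB: the library norm on 'rV is the max norm). *)
Definition dotp (R : realType) (d : nat) (x y : 'rV[R]_(d.+1)) : R :=
  \sum_(i < d.+1) x ord0 i * y ord0 i.

Definition sphere (R : realType) (d : nat) : set 'rV[R]_(d.+1) :=
  [set x | dotp x x = 1].

Definition cap (R : realType) (d : nat) (z : 'rV[R]_(d.+1)) (r : R)
  : set 'rV[R]_(d.+1) :=
  [set y | sphere y /\ cos r <= dotp z y].

Definition orthogonal_mx (R : realType) (d : nat) (O : 'M[R]_(d.+1)) : Prop :=
  O *m O^T = 1%:M.

(* sigma is the normalized surface measure on S^d, characterized as a
   rotation-invariant Borel probability measure on R^(d+1) concentrated
   on S^d (such a measure is unique). *)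
Definition normalized_surface_measure (R : realType) (d : nat)
  (sigma : {measure set (Rsp R d) -> \bar R}) : Prop :=
  [/\ sigma setT = 1%E,
      sigma (~` @sphere R d) = 0%E &
      forall O : 'M[R]_(d.+1), orthogonal_mx O ->
        forall E : set (Rsp R d), measurable E ->
          sigma ((fun x : 'rV[R]_(d.+1) => x *m O) @^-1` E) = sigma E].

Definition finite_measure_on_sphere (R : realType) (d : nat)
  (mu : {measure set (Rsp R d) -> \bar R}) : Prop :=
  (mu setT < +oo)%E /\ mu (~` @sphere R d) = 0%E.

(* Pi_t : (real) polynomial functions in d+1 variables of total degree <= t,
   written out as linear combinations of monomials x^m with |m| <= t.
   (Each exponent of such a monomial is <= t, so multi-indices range over
   {ffun 'I_(d+1) -> 'I_(t+1)}.) *)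
Definition Pi (R : realType) (d t : nat) (f : 'rV[R]_(d.+1) -> R) : Prop :=
  exists c : {ffun 'I_(d.+1) -> 'I_(t.+1)} -> R,
    forall x : 'rV[R]_(d.+1),
      f x = \sum_(m : {ffun 'I_(d.+1) -> 'I_(t.+1)} | (\sum_(i < d.+1) (m i : nat) <= t)%N)
              c m * \prod_(i < d.+1) (x ord0 i) ^+ (m i).

Definition dimPi (d t : nat) : nat := ('C(d + t, t) + 'C(d + t - 1, t - 1))%N.

Definition sqnorm (R : realType) (d : nat)
  (nu : {measure set (Rsp R d) -> \bar R}) (f : 'rV[R]_(d.+1) -> R) : \bar R :=
  (\int[nu]_x ((f x) ^+ 2)%:E)%E.

Definition MZ (R : realType) (d t : nat)
  (sigma mu : {measure set (Rsp R d) -> \bar R}) (a A : R) : Prop :=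
  forall f, @Pi R d t f ->
    (a%:E * sqnorm sigma f <= sqnorm mu f /\ sqnorm mu f <= A%:E * sqnorm sigma f)%E.

Definition M_d (R : realType) (d : nat) : R :=
  2 * expR 1 / pi * (2 + Num.sqrt ((d%:R) ^+ 2 / 2 - d%:R + 1)).

Definition V_d (R : realType) (d : nat) (a A eps : R) : R :=
  (A / a) / (1 - eps) * pi * M_d R d * (d%:R) ^+ 2
  * powR 2 (d%:R / 2 + 6) * (Num.sqrt d%:R / expR 1) ^+ d.

(* Main.v *)
Require Import Defs.
From HB Require Import structures.
From mathcomp Require Import all_boot all_order all_algebra.
From mathcomp Require Import all_classical all_reals all_analysis.
From mathcomp Require Import measurable_realfun ring lra zify.
Set Implicit Arguments. Unset Strict Implicit. Unset Printing Implicit Defensive.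
Import Order.TTheory GRing.Theory Num.Theory.
Import numFieldNormedType.Exports.
Local Open Scope classical_set_scope.
Local Open Scope ring_scope.

(* The polynomials [f = p ^ (4 d)] and [g = p ^ d] are powers of the normalized
   Dirichlet kernel [p] of degree [n ~ t / (28 d ^ 2)], evaluated at [z . x].
   Since [p ^ 2 (1 - z . x) <= 2 / (2 n + 1) ^ 2], one has [f ^ 2 <= 1] on the cap and
   [f ^ 2 <= q g ^ 2] off it, with [q] tiny once [n r] is large.  The
   Marcinkiewicz-Zygmund inequalities then give
     [a int f ^ 2 dsigma <= mu (cap) + q A int g ^ 2 dsigma],
   and it remains to compare both integrals with [b := sigma (B)], where [B] is a
   cap around [z] of radius about [1 / n]: [int f ^ 2 >= b / 2] because [f] is
   large on [B], [int g ^ 2 <= C b] by summing over dyadic caps, whose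
   measures are controlled by counting how many rotated copies of [B] cover them,
   and [b >= 2 / dim] by the same count for the whole sphere. *)

(** * Trigonometric estimates and the peak polynomial *)

Section trigonometry.
Variable R : realType.
Implicit Types x y r s : R.

Lemma sin_le_id x : 0 <= x -> sin x <= x.
Proof.
move=> x0; have [c _] := MVT_segment x0 (fun y _ => is_derive_sin y)
  (continuous_subspaceT (@continuous_sin R)).
by rewrite sin0 !subr0 => ->; rewrite ler_piMl// cos_le1.
Qed.

Lemma cos_half_sin x : cos x = 1 - 2 * sin (x / 2) ^+ 2.
Proof. by rewrite {1}[x]splitr -mulr2n cos_mulr2n cos2sin2; ring. Qed.

Lemma sin_half x : sin x = 2 * sin (x / 2) * cos (x / 2).
Proof. by rewrite {1}[x]splitr sinD; ring. Qed.

Lemma cos_ge_quad x : 0 <= x <= 2 -> 1 - x ^+ 2 / 2 <= cos x.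
Proof.
move=> /andP[x0 x2]; rewrite cos_half_sin.
have s0 : 0 <= sin (x / 2).
  by rewrite sin_ge0_pi//; apply/andP; split; [lra|have := pi_ge2 R; lra].
have := @sin_le_id (x / 2); rewrite divr_ge0// => /(_ isT); nra.
Qed.

Lemma sin_ge_quad x : 0 <= x <= 1 -> x * (1 - x ^+ 2 / 2) <= sin x.
Proof.
move=> /andP[x0 x2]; have [c] := MVT_segment x0 (fun y _ => is_derive_sin y)
  (continuous_subspaceT (@continuous_sin R)).
rewrite in_itv/= => /andP[c0 cx]; rewrite sin0 !subr0 => ->.
rewrite mulrC ler_wpM2r//; apply: (@le_trans _ _ (1 - c ^+ 2 / 2)).
  by rewrite lerD2l lerN2 ler_pM2r ?invr_gt0// ler_sqr ?nnegrE.
by apply: cos_ge_quad; rewrite c0; lra.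
Qed.

(** The double-angle formula turns the quadratic bounds at [x / 2] into a bound that stays valid
    past [pi / 2]. *)
Lemma sin_ge_cubed x : 0 <= x <= 2 -> x * (1 - x ^+ 2 / 8) ^+ 2 <= sin x.
Proof.
move=> /andP[x0 x2]; rewrite sin_half.
have := @sin_ge_quad (x / 2); have := @cos_ge_quad (x / 2).
rewrite divr_ge0//= => H1 H2.
have {}H1 : 1 - x ^+ 2 / 8 <= cos (x / 2) by apply: (le_trans _ (H1 _)); lra.
have {}H2 : x / 2 * (1 - x ^+ 2 / 8) <= sin (x / 2).
  by apply: (le_trans _ (H2 _)); lra.
have p : 0 <= 1 - x ^+ 2 / 8 by nra.
have q : 0 <= x / 2 * (1 - x ^+ 2 / 8) by rewrite mulr_ge0// divr_ge0.
have := ler_pM q p H2 H1; nra.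
Qed.

(** A rational substitute for Jordan's constant [2 / pi]. The cubed bound works up to [6 / 5];
    beyond that [sin] increases, and [5 / 12 * x <= 5 / 6 <= sin (6 / 5)] because [pi / 2 < 2]. *)
Lemma sin_ge_linear x : 0 <= x <= pi / 2 -> 5 / 12 * x <= sin x.
Proof.
move=> /andP[x0 x2].
have pi2 := @pihalf_lt2 R.
have [x65|x65] := leP x (6 / 5).
  apply: (le_trans _ (sin_ge_cubed _)); last by rewrite x0; lra.
  have : x ^+ 2 / 8 <= 9 / 50 by nra.
  have : 0 <= x ^+ 2 / 8 by rewrite divr_ge0// sqr_ge0.
  by move: (x ^+ 2 / 8) => y y0 yle; rewrite mulrC ler_wpM2l//; nra.
have : sin (6 / 5) <= sin x.
  by apply: ltW; rewrite ltr_sin// in_itv/=; lra.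
have : 5 / 6 <= sin (6 / 5 : R).
  rewrite sin_half.
  have -> : 6 / 5 / 2 = 3 / 5 :> R by lra.
  have H1 : 1 - (3 / 5) ^+ 2 / 2 <= cos (3 / 5 : R) by apply: cos_ge_quad; lra.
  have H2 : 3 / 5 * (1 - (3 / 5) ^+ 2 / 8) ^+ 2 <= sin (3 / 5 : R).
    by apply: sin_ge_cubed; lra.
  by nra.
lra.
Qed.

Lemma one_sub_cos_ge r : 0 <= r <= pi -> 25 / 288 * r ^+ 2 <= 1 - cos r.
Proof.
move=> /andP[r0 rpi]; rewrite cos_half_sin.
have : 5 / 12 * (r / 2) <= sin (r / 2).
  by apply: sin_ge_linear; apply/andP; split; lra.
by nra.
Qed.

Lemma norm_sin_muln n x : `|sin (n%:R * x)| <= n%:R * `|sin x|.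
Proof.
elim: n => [|n IH]; first by rewrite !mul0r sin0 normr0.
rewrite -natr1 mulrDl mul1r sinD (le_trans (ler_normD _ _))// !normrM mulrDl mul1r.
apply: lerD.
  by apply: le_trans IH; rewrite ler_piMr// ler_norml cos_geN1 cos_le1.
by rewrite ler_piMl// ler_norml cos_geN1 cos_le1.
Qed.

(** Squaring [norm_sin_muln] at [x / 2], since [1 - cos x = 2 sin (x / 2) ^ 2]. *)
Lemma one_sub_cos_muln n x : 1 - cos (n%:R * x) <= n%:R ^+ 2 * (1 - cos x).
Proof.
rewrite (cos_half_sin x) cos_half_sin -mulrA.
have := norm_sin_muln n (x / 2).
move: (n%:R : R) (ler0n R n) => m m0 H.
have : sin (m * (x / 2)) ^+ 2 <= (m * sin (x / 2)) ^+ 2.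
  by rewrite -ler_sqrt ?sqr_ge0// !sqrtr_sqr normrM (ger0_norm m0).
by rewrite exprMn; lra.
Qed.

End trigonometry.

Section peak_polynomial.
Variable R : realType.
Implicit Types x s : R.

Lemma chebyshev_poly n : exists p : {poly R}, (size p <= n.+1)%N /\
  forall x, p.[cos x] = cos (n%:R * x).
Proof.
(* Two consecutive Chebyshev polynomials are carried along, because the recurrence
   [T_(n+2) = 2 X T_(n+1) - T_n] uses both. *)
suff: exists p q : {poly R}, [/\ (size p <= n.+1)%N, (size q <= n.+2)%N,
    forall x, p.[cos x] = cos (n%:R * x)
  & forall x, q.[cos x] = cos (n.+1%:R * x)].
  by move=> [p [q [sp _ hp _]]]; exists p.
elim: n => [|n [p [q [sp sq hp hq]]]].
  exists 1, 'X; split; rewrite ?size_poly1 ?size_polyX//.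
    by move=> x; rewrite hornerC mul0r cos0.
  by move=> x; rewrite hornerX mul1r.
exists q, (2%:P * ('X * q) - p); split => //.
  rewrite (leq_trans (size_polyD _ _))// size_polyN geq_max; apply/andP; split.
    rewrite mul_polyC (leq_trans (size_scale_leq _ _))//.
    by rewrite (leq_trans (size_polyMleq _ _))// size_polyX.
  by rewrite (leq_trans sp)// ltnW.
move=> x; rewrite hornerD hornerN !hornerM hornerC hornerX hq hp.
have -> : n.+2%:R * x = n.+1%:R * x + x by rewrite -[n.+2]addn1 natrD mulrDl mul1r.
have -> : n%:R * x = n.+1%:R * x - x by rewrite -natr1 mulrDl mul1r addrK.
by rewrite !cosD cosN sinN; ring.
Qed.

Lemma dirichlet_poly n : exists p : {poly R}, (size p <= n.+1)%N /\
  forall x, p.[cos x] = 1 + 2 * \sum_(j < n) cos (j.+1%:R * x).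
Proof.
elim: n => [|n [p [sp hp]]].
  exists 1; rewrite size_poly1; split=> // x.
  by rewrite hornerC big_ord0 mulr0 addr0.
have [q [sq hq]] := chebyshev_poly n.+1.
exists (p + 2%:P * q); split.
  rewrite (leq_trans (size_polyD _ _))// geq_max (leq_trans sp)//=.
  by rewrite mul_polyC (leq_trans (size_scale_leq _ _)).
by move=> x; rewrite hornerD hornerM hornerC hp hq big_ord_recr/=; ring.
Qed.

(** Telescoping: [2 cos (k x) sin (x / 2) = sin (k x + x / 2) - sin (k x - x / 2)]. *)
Lemma dirichlet_sin n x :
  (1 + 2 * \sum_(j < n) cos (j.+1%:R * x)) * sin (x / 2) =
  sin (n%:R * x + x / 2).
Proof.
elim: n => [|n IH]; first by rewrite big_ord0 mulr0 addr0 mul1r mul0r add0r.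
rewrite big_ord_recr/= mulrDr addrA mulrDl {}IH.
have -> : n%:R * x + x / 2 = n.+1%:R * x - x / 2.
  by rewrite -[n.+1%:R]natr1; lra.
by rewrite !sinD cosN sinN; ring.
Qed.

(* The normalized Dirichlet kernel of degree [n]. *)
Lemma peak_poly n : exists p : {poly R}, (size p <= n.+1)%N /\
  forall s, -1 <= s <= 1 ->
    [/\ `|p.[s]| <= 1,
        p.[s] ^+ 2 * (1 - s) <= 2 / n.*2.+1%:R ^+ 2
      & 1 - n%:R ^+ 2 * (1 - s) <= p.[s]].
Proof.
have [p [sp hp]] := dirichlet_poly n.
pose m : R := n.*2.+1%:R.
have mE : m = 2 * n%:R + 1 by rewrite /m -natr1 -muln2 natrM mulrC.
have m0 : 0 < m by rewrite /m ltr0n.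
(* The Dirichlet kernel takes the value [m = 2 n + 1] at [s = 1]. *)
exists (m^-1 *: p); split; first by rewrite (leq_trans (size_scale_leq _ _)).
move=> s s1; have := @acosK R s; rewrite in_itv/= s1 => /(_ isT).
move: (acos s) => x <-; rewrite hornerZ hp.
set D := 1 + _; split.
- rewrite normrM gtr0_norm ?invr_gt0// ler_pdivrMl// mulr1.
  rewrite (le_trans (ler_normD _ _))// normr1 mE addrC lerD2r normrM ger0_norm//.
  rewrite ler_wpM2l// (le_trans (ler_norm_sum _ _ _))//.
  apply: (@le_trans _ _ (\sum_(j < n) 1)); last by rewrite sumr_const card_ord.
  by apply: ler_sum => j _; rewrite ler_norml cos_geN1 cos_le1.
(* With [1 - s = 2 sin (x / 2) ^ 2], the product [D ^ 2 * (1 - s)] becomes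
   [2 sin (n x + x / 2) ^ 2], which is at most 2. *)
- rewrite exprMn exprVn -mulrA mulrC ler_pM2r ?invr_gt0 ?exprn_gt0//.
  rewrite (cos_half_sin x) opprB addrCA subrr addr0 mulrCA -exprMn dirichlet_sin.
  by rewrite ler_piMr// sin2cos2 gerBl sqr_ge0.
- rewrite [leRHS]mulrC ler_pdivlMr//.
  have u0 : 0 <= 1 - cos x by rewrite subr_ge0 cos_le1.
  have H : n%:R - n%:R ^+ 3 * (1 - cos x) <= \sum_(j < n) cos (j.+1%:R * x).
    have -> : n%:R - n%:R ^+ 3 * (1 - cos x) =
        \sum_(j < n) (1 - n%:R ^+ 2 * (1 - cos x)).
      by rewrite sumr_const card_ord -mulr_natl; ring.
    apply: ler_sum => j _; rewrite lerBlDr -lerBlDl.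
    rewrite (le_trans (one_sub_cos_muln _ _))// ler_wpM2r// ler_sqr ?nnegrE//.
    by rewrite ler_nat.
  rewrite mE /D; have := ler0n R n; move: (n%:R : R) u0 H => y; move: (1 - cos x) => u.
  move=> u0 H y0; have : 0 <= y ^+ 2 * u by rewrite mulr_ge0// sqr_ge0.
  by nra.
Qed.

End peak_polynomial.

(** * Zonal polynomials *)

Section zonal_polynomials.
Variables (R : realType) (d t : nat).
Implicit Types x z : 'rV[R]_d.+1.

Lemma Pi_lincomb (I : finType) (c : I -> R) (f : I -> 'rV[R]_d.+1 -> R) :
  (forall i, Pi t (f i)) -> Pi t (fun x => \sum_i c i * f i x).
Proof.
move=> /choice[C fC]; exists (fun m => \sum_i c i * C i m) => x.
under eq_bigr => i _ do rewrite fC mulr_sumr.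
rewrite exchange_big/=; apply: eq_bigr => m _.
by rewrite mulr_suml; apply: eq_bigr => i _; rewrite mulrA.
Qed.

Lemma Pi_monomial (m : 'I_d.+1 -> nat) : (\sum_i m i <= t)%N ->
  Pi t (fun x => \prod_i x ord0 i ^+ m i).
Proof.
move=> mt; have mit i : (m i < t.+1)%N.
  by rewrite ltnS (leq_trans _ mt)// (bigD1 i)//= leq_addr.
pose m0 : {ffun 'I_d.+1 -> 'I_t.+1} := [ffun i => Ordinal (mit i)].
have m0E i : m0 i = m i :> nat by rewrite ffunE.
exists (fun k => (k == m0)%:R) => x.
rewrite (bigD1 m0)/=; last by rewrite (eq_bigr m)// => i _; rewrite m0E.
rewrite eqxx mul1r [X in _ = _ + X]big1 ?addr0.
  by apply: eq_bigr => i _; rewrite m0E.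
by move=> k /andP[_ /negPf->]; rewrite mul0r.
Qed.

(** Expanding the [j]-fold product of sums gives one term for each map [phi] from factors to
    coordinates. Its exponents are the fibre sizes of [phi], which add up to [j]. *)
Lemma Pi_dotp_exp z j : (j <= t)%N -> Pi t (fun x => dotp z x ^+ j).
Proof.
move=> jt; pose mon (phi : {ffun 'I_j -> 'I_d.+1}) i := #|[pred l | phi l == i]|.
have -> : (fun x => dotp z x ^+ j) = (fun x =>
    \sum_(phi : {ffun 'I_j -> 'I_d.+1})
      (\prod_l z ord0 (phi l)) * \prod_i x ord0 i ^+ mon phi i).
  apply/funext => x; rewrite -[in LHS](card_ord j) -prodr_const bigA_distr_bigA/=.
  apply: eq_bigr => phi _; rewrite big_split/=; congr (_ * _).
  rewrite (partition_big phi predT)//=; apply: eq_bigr => i _.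
  by rewrite (eq_bigr (fun=> x ord0 i)) ?prodr_const// => l /eqP->.
apply: Pi_lincomb => phi; apply: Pi_monomial; rewrite (leq_trans _ jt)//.
rewrite -[leqRHS](card_ord j) -sum1_card (partition_big phi predT)//=.
by apply: leq_sum => i _; rewrite sum1_card.
Qed.

Lemma Pi_zonal z (p : {poly R}) : (size p <= t.+1)%N ->
  Pi t (fun x => p.[dotp z x]).
Proof.
move=> sp; have -> : (fun x => p.[dotp z x]) =
    (fun x => \sum_(i < size p) p`_i * dotp z x ^+ i).
  by apply/funext => x; rewrite horner_coef.
by apply: Pi_lincomb => i; apply: Pi_dotp_exp; rewrite -ltnS (leq_trans _ sp).
Qed.

End zonal_polynomials.

(** * Geometry of the sphere *)

Section sphere_geometry.
Variables (R : realType) (d : nat).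
Implicit Types x y z : 'rV[R]_d.+1.

Lemma dotpE x y : dotp x y = (x *m y^T) ord0 ord0.
Proof. by rewrite mxE; apply: eq_bigr => i _; rewrite mxE. Qed.

Lemma dotp_mulmx z x (O : 'M[R]_d.+1) : dotp z (x *m O) = dotp (z *m O^T) x.
Proof. by rewrite !dotpE trmx_mul mulmxA. Qed.

(** The law of cosines with free coefficients: [1] and [-1] give the Cauchy-Schwarz bounds on the
    sphere, scalings at least 1 give the radial projection. *)
Lemma dotp_sub_sqr (a b : R) x y :
  \sum_i (a * x ord0 i - b * y ord0 i) ^+ 2 =
  a ^+ 2 * dotp x x + b ^+ 2 * dotp y y - 2 * a * b * dotp x y.
Proof.
rewrite /dotp !mulr_sumr -sumrN -!big_split/=; apply: eq_bigr => i _; ring.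
Qed.

Lemma dotp_le1 x y : sphere x -> sphere y -> dotp x y <= 1.
Proof.
rewrite /sphere/= => sx sy; have := dotp_sub_sqr 1 1 x y; rewrite sx sy => h.
have : 0 <= \sum_i (1 * x ord0 i - 1 * y ord0 i) ^+ 2.
  by apply: sumr_ge0 => i _; exact: sqr_ge0.
by rewrite h; lra.
Qed.

Lemma dotp_geN1 x y : sphere x -> sphere y -> -1 <= dotp x y.
Proof.
rewrite /sphere/= => sx sy; have := dotp_sub_sqr 1 (-1) x y; rewrite sx sy => h.
have : 0 <= \sum_i (1 * x ord0 i - -1 * y ord0 i) ^+ 2.
  by apply: sumr_ge0 => i _; exact: sqr_ge0.
by rewrite h; lra.
Qed.

(* Radial projection onto the sphere contracts the exterior of the ball. *)
Lemma dist_radial_proj (a b : R) x y : sphere x -> sphere y -> 1 <= a -> 1 <= b ->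
  2 * (1 - dotp x y) <= \sum_i (a * x ord0 i - b * y ord0 i) ^+ 2.
Proof.
move=> sx sy a1 b1; have := dotp_le1 sx sy; rewrite dotp_sub_sqr sx sy.
move: (dotp x y) => c c1.
(* This is exactly the difference of the two sides of the goal. *)
have : 0 <= (a - b) ^+ 2 + 2 * (a * b - 1) * (1 - c).
  by rewrite addr_ge0 ?sqr_ge0// mulr_ge0 ?subr_ge0// mulr_ge0// subr_ge0; nra.
by nra.
Qed.

Lemma sphere_coord_le1 x i : sphere x -> `|x ord0 i| <= 1.
Proof.
rewrite /sphere/= => sx; rewrite -(@ler_pXn2r _ 2%N) ?nnegrE// expr1n.
rewrite real_normK ?num_real// -sx /dotp (bigD1 i)//= -expr2.
by rewrite lerDl sumr_ge0// => j _; rewrite -expr2 sqr_ge0.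
Qed.

(** The reflection in the hyperplane orthogonal to [v = z - z'] exchanges [z] and [z']; the case
    [v = 0] is handled by the identity. *)
Lemma householder z z' : sphere z -> sphere z' ->
  exists O : 'M[R]_d.+1, orthogonal_mx O /\ z' *m O^T = z.
Proof.
move=> sz sz'; have [<-|zz'] := eqVneq z z'.
  by exists 1%:M; rewrite /orthogonal_mx trmx1 !mulmx1.
pose v := z - z'; pose c := dotp v v.
have cE : c = 2 - 2 * dotp z z'.
  have := dotp_sub_sqr 1 1 z z'; rewrite (sz : _ = _) (sz' : _ = _).
  have -> : \sum_i (1 * z ord0 i - 1 * z' ord0 i) ^+ 2 = c.
    by apply: eq_bigr => i _; rewrite !mul1r !mxE expr2.
  by move=> ->; lra.
have c0 : c != 0.
  apply: contra zz' => /eqP; rewrite /c /dotp => /eqP.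
  rewrite psumr_eq0; last by move=> i _; rewrite -expr2 sqr_ge0.
  move=> /allP h; apply/eqP/rowP => i; apply/eqP; rewrite -subr_eq0.
  by have := h i (mem_index_enum _); rewrite -expr2 sqrf_eq0 !mxE.
have vv : v *m v^T = c%:M.
  by apply/matrixP => i j; rewrite !ord1 -dotpE mxE eqxx.
pose P := v^T *m v.
have PT : P^T = P by rewrite /P trmx_mul trmxK.
have PP : P *m P = c *: P.
  by rewrite /P mulmxA -(mulmxA v^T) vv mul_mx_scalar -scalemxAl.
have zP : z' *m P = (dotp z z' - 1) *: v.
  rewrite /P mulmxA; have -> : z' *m v^T = (dotp z z' - 1)%:M.
    apply/matrixP => i j; rewrite !ord1 -dotpE [RHS]mxE eqxx mulr1n.
    rewrite -(sz' : dotp z' z' = 1) /dotp -sumrB; apply: eq_bigr => k _.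
    by rewrite !mxE; ring.
  by rewrite mul_scalar_mx.
pose O := 1%:M - (2 / c) *: P.
have OT : O^T = O by rewrite /O linearB/= linearZ/= trmx1 PT.
exists O; rewrite /orthogonal_mx OT; split.
  rewrite /O mulmxBl mul1mx mulmxBr mulmx1 -scalemxAl -scalemxAr PP !scalerA.
  have -> : 2 / c * (2 / c) * c = 2 / c + 2 / c by field.
  by rewrite scalerDl opprB addrA; apply/matrixP => i j; rewrite !mxE; ring.
rewrite /O mulmxBr mulmx1 -scalemxAr zP scalerA.
have -> : 2 / c * (dotp z z' - 1) = -1.
  have c1 : 2 - 2 * dotp z z' != 0 by rewrite -cE.
  by rewrite cE; field.
by rewrite scaleN1r opprK /v addrC subrK.
Qed.

End sphere_geometry.

(** * Grids on an interval *)

Section grid.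
Variables (R : realType) (tau h : R).
Hypotheses (tau0 : 0 <= tau) (h0 : 0 < h).

Definition grid_size := Num.truncn (2 * tau / h).

(** The interval from [- tau] to [tau] is cut into pieces of length [h]. The extra index receives
    the last, possibly shorter piece with the endpoint [tau]; [inord] makes the map total, and it is
    meaningful only for arguments of absolute value at most [tau]. *)
Definition grid_cell (y : R) : 'I_grid_size.+1 := inord (Num.truncn ((y + tau) / h)).

Lemma grid_size_le : grid_size.+1%:R <= 2 * tau / h + 1.
Proof.
rewrite -natr1 lerD2r truncn_le divr_ge0// ?mulr_ge0//; exact: ltW.
Qed.

Lemma grid_cell_close y y' : `|y| <= tau -> `|y'| <= tau ->
  grid_cell y = grid_cell y' -> (y - y') ^+ 2 <= h ^+ 2.
Proof.
rewrite !ler_norml => /andP[y1 y2] /andP[y'1 y'2].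
have bnd w : - tau <= w -> w <= tau -> 0 <= (w + tau) / h /\
    (Num.truncn ((w + tau) / h) <= grid_size)%N.
  move=> w1 w2; split; first by rewrite divr_ge0 ?(ltW h0)// -lerBlDr sub0r.
  by rewrite /grid_size le_truncn// ler_pM2r ?invr_gt0//; lra.
have [py gy] := bnd y y1 y2; have [py' gy'] := bnd y' y'1 y'2.
move=> /(congr1 val); rewrite /= !inordK// => e.
have := truncn_itv py; have := truncn_itv py'; rewrite -e => /andP[a1 a2] /andP[b1 b2].
have h1 : `|y - y'| <= h.
  have -> : y - y' = ((y + tau) / h - (y' + tau) / h) * h.
    by field; rewrite gt_eqF.
  rewrite normrM (gtr0_norm h0) ler_piMl ?(ltW h0)// ler_norml.
  by move: a1 a2 b1 b2; rewrite -natr1; lra.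
by rewrite -(real_normK (num_real (y - y'))) ler_sqr ?nnegrE ?(ltW h0)//.
Qed.

End grid.

(** * The constants of the theorem *)

Section constants.
Variable R : realType.

Lemma expR1_le3 : expR 1 <= 3 :> R.
Proof.
have h : 5 / 6 <= expR (- (1 / 6)) :> R by apply: le_trans (expR_ge1Dx _); lra.
have : (5 / 6) ^+ 6 <= expR (- 1) :> R.
  have -> : - 1 = 6%:R * - (1 / 6) :> R by lra.
  by rewrite expRM_natl lerXn2r// nnegrE ?expR_ge0//; lra.
rewrite expRN => h1; rewrite -[leLHS]invrK -[leRHS]invrK lef_pV2 ?posrE ?invr_gt0 ?expR_gt0//.
by apply: le_trans h1; lra.
Qed.

(** After squaring, this is [y <= expR (y - 1)] at [y = expR 1 / x]. With [x = 2 d] the [d]-th power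
    of the left side is [expR (- (expR 1 / 4))], free of [d]. *)
Lemma sqrt_ge_expR (x : R) : 0 < x ->
  expR (- (expR 1 / (2 * x))) <= Num.sqrt x / expR 1.
Proof.
move=> x0; have e0 := expR_gt0 (1 : R).
rewrite ler_pdivlMr// -expRD -[leLHS]ger0_norm ?expR_ge0// -sqrtr_sqr.
rewrite ler_wsqrtr// -expRM_natl.
set y := expR 1 / x.
have y0 : 0 < y by rewrite divr_gt0.
have -> : 2%:R * (- (expR 1 / (2 * x)) + 1) = 1 - (y - 1) :> R.
  by rewrite /y; field; rewrite gt_eqF//.
rewrite expRB ler_pdivrMr ?expR_gt0//.
have := expR_ge1Dx (y - 1); rewrite addrCA subrr addr0 => h.
apply: (@le_trans _ _ (x * y)); first by rewrite /y mulrCA divff ?mulr1// gt_eqF.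
by rewrite ler_pM2l.
Qed.

(** Replaces [V_d] by a polynomial in [d]. The square root in [M_d] is at least [d / 2], and [e
    (sqrt (2 d) / e) ^ d >= e ^ (1 - e / 4) >= 2 - e / 4 >= 5 / 4]; then
    [80 (d + 4) = 5 / 4 * 128 * (2 + d / 2)]. *)
Lemma V_d_ge (d : nat) (a A eps : R) : (1 <= d)%N -> 0 < eps < 1 -> 0 < a ->
  a <= A ->
  80 * d%:R ^+ 2 * (d%:R + 4) * (A / a / (1 - eps)) <= V_d d a A eps.
Proof.
move=> d1 /andP[e0 e1] a0 aA; rewrite /V_d /M_d.
set k := A / a / (1 - eps).
have k0 : 0 <= k by rewrite /k !divr_ge0//; lra.
have d0 : 0 < d%:R :> R by rewrite ltr0n.
have pi0 := pi_gt0 R.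
have -> : powR 2 (d%:R / 2 + 6) = 64 * Num.sqrt 2 ^+ d :> R.
  rewrite powRD ?pnatr_eq0 ?implybT// powR_mulrn// [d%:R / 2]mulrC.
  rewrite powRrM powR12_sqrt// powR_mulrn ?sqrtr_ge0// mulrC; congr (_ * _).
  by ring.
have hsq : d%:R / 2 <= Num.sqrt (d%:R ^+ 2 / 2 - d%:R + 1) :> R.
  rewrite -[leLHS]ger0_norm ?divr_ge0// -sqrtr_sqr ler_wsqrtr//.
  have := sqr_ge0 (d%:R / 2 - 1 : R); nra.
have hpow : 5 / 4 <= expR 1 * (Num.sqrt 2 ^+ d * (Num.sqrt d%:R / expR 1) ^+ d) :> R.
  rewrite -exprMn mulrA -sqrtrM//.
  have x0 : 0 < 2 * d%:R :> R by rewrite mulr_gt0.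
  apply: (@le_trans _ _ (expR 1 * (expR (- (expR 1 / (2 * (2 * d%:R))))) ^+ d)).
    rewrite -expRM_natl -expRD.
    have -> : 1 + d%:R * - (expR 1 / (2 * (2 * d%:R))) = 1 - expR 1 / 4 :> R.
      by field; rewrite gt_eqF//.
    by apply: le_trans (expR_ge1Dx _); have := expR1_le3; lra.
  rewrite ler_wpM2l ?expR_ge0// lerXn2r// ?nnegrE ?expR_ge0//.
  exact: sqrt_ge_expR.
have -> : k * pi * (2 * expR 1 / pi * (2 + Num.sqrt (d%:R ^+ 2 / 2 - d%:R + 1))) *
   d%:R ^+ 2 * (64 * Num.sqrt 2 ^+ d) * (Num.sqrt d%:R / expR 1) ^+ d =
   (expR 1 * (Num.sqrt 2 ^+ d * (Num.sqrt d%:R / expR 1) ^+ d)) *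
   (2 + Num.sqrt (d%:R ^+ 2 / 2 - d%:R + 1)) * (128 * d%:R ^+ 2 * k) :> R.
  move: (@pi R) pi0 ((Num.sqrt d%:R / expR 1) ^+ d) => q q0 w.
  by field; rewrite gt_eqF.
apply: (@le_trans _ _ (5 / 4 * (2 + d%:R / 2) * (128 * d%:R ^+ 2 * k))); first by nra.
apply: ler_wpM2r; first by apply: mulr_ge0 => //; apply: mulr_ge0 => //; exact: sqr_ge0.
by apply: ler_pM; [lra|lra|exact: hpow|rewrite lerD2l].
Qed.

(** The binomial is the product of [(t - 1 + k) / k] for [1 <= k <= i], and each factor is at least
    [t / d] since [k <= d]. *)
Lemma exp_le_bin t d i : (1 <= t)%N -> (i <= d)%N ->
  (t ^ i <= d ^ i * 'C(t.-1 + i, i))%N.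
Proof.
case: t => // t _; elim: i => [|i IH] id; first by rewrite bin0.
rewrite -(leq_pmul2l (ltn0Sn i)).
have -> : (i.+1 * (d ^ i.+1 * 'C(t + i.+1, i.+1)) =
    d * (t.+1 + i) * (d ^ i * 'C(t + i, i)))%N.
  rewrite addnS mulnCA -mul_bin_diag expnS addSn -!mulnA; congr (_ * _)%N.
  by rewrite mulnCA.
rewrite expnS mulnA; apply: leq_mul; last exact: IH (ltnW id).
by apply: leq_mul => //; exact: leq_addr.
Qed.

(** Both binomials in [dimPi] are at least ['C(t - 1 + d, d)], to which [exp_le_bin] applies with
    [i = d]. *)
Lemma dimPi_ge d t : (1 <= d)%N -> (1 <= t)%N ->
  2 * (t%:R / d%:R) ^+ d <= (dimPi d t)%:R :> R.
Proof.
case: t => // t d1 t1; have := exp_le_bin t1 (leqnn d); rewrite /= => h.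
rewrite exprMn exprVn mulrA ler_pdivrMr ?exprn_gt0 ?ltr0n// -!natrX -!natrM ler_nat.
rewrite /dimPi !subn1 addnS/= -['C((d + t).+1, _)]bin_sub; last by rewrite ltnS leq_addl.
rewrite subSS addnK -['C(d + t, t)]bin_sub ?leq_addl// addnK.
rewrite (addnC t d) in h; rewrite mul2n -addnn mulnDl.
by apply: leq_add; rewrite mulnC (leq_trans h)// leq_mul2l leq_bin2l ?orbT.
Qed.

End constants.

(** * Coverings and the surface measure *)

Section surface_measure.
Variables (R : realType) (d : nat).
Implicit Types (x z : 'rV[R]_d.+1).

Lemma measurable_coord (i : 'I_d.+1) :
  measurable_fun setT (fun x : Rsp R d => (x : 'rV[R]_d.+1) ord0 i).
Proof.
apply: (measurability _ (RGenOInfty.measurableE R)).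
move=> _ [_ [a ->]] <-; rewrite setTI; apply: sub_sigma_algebra.
apply: open_comp; last exact: interval_open.
by move=> x _; exact: coord_continuous.
Qed.

Lemma measurable_dotp z : measurable_fun setT (fun x : Rsp R d => dotp z x).
Proof.
apply: measurable_sum => i; apply: measurable_funM => //.
exact: measurable_coord.
Qed.

Lemma measurable_sphere : measurable (@sphere R d : set (Rsp R d)).
Proof.
have : measurable_fun setT (fun x : Rsp R d => dotp x x).
  by apply: measurable_sum => i; apply: measurable_funM; exact: measurable_coord.
by move=> /(_ measurableT [set 1] (measurable_set1 1)); rewrite setTI.
Qed.

Definition halfspace z (v : R) : set (Rsp R d) := [set x | 1 - dotp z x <= v].

Lemma measurable_halfspace z v : measurable (halfspace z v).
Proof.
have := measurable_dotp z measurableT (measurable_itv `[1 - v, +oo[).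
rewrite setTI; congr measurable; apply/seteqP; split => x /=;
  by rewrite /halfspace/= in_itv/= andbT; lra.
Qed.

Lemma measurable_cap z r : measurable (@cap R d z r : set (Rsp R d)).
Proof.
have -> : @cap R d z r = @sphere R d `&` halfspace z (1 - cos r).
  by apply/seteqP; split => x [sx h]; split => //; move: h; rewrite /halfspace/=; lra.
exact: measurableI measurable_sphere (measurable_halfspace _ _).
Qed.

Lemma measurable_zonal (p : {poly R}) z :
  measurable_fun setT (fun x : Rsp R d => p.[dotp z x]).
Proof.
apply: (@measurableT_comp _ _ _ _ _ _ (fun s => p.[s])); last exact: measurable_dotp.
by apply: continuous_measurable_fun; exact: continuous_horner.
Qed.

Variable sigma : {measure set (Rsp R d) -> \bar R}.
Hypothesis sigmaP : normalized_surface_measure sigma.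

Lemma halfspace_rotation z z' v : sphere z -> sphere z' ->
  sigma (halfspace z v) = sigma (halfspace z' v).
Proof.
move=> sz sz'; have [Q [orthQ zQ]] := householder sz sz'.
case: sigmaP => _ _ /(_ Q orthQ _ (measurable_halfspace z' v)) <-.
congr (sigma _); apply/seteqP; split => x; rewrite /halfspace/= dotp_mulmx zQ//.
Qed.

Lemma surface_measureIS (E : set (Rsp R d)) : measurable E ->
  sigma E = sigma (E `&` @sphere R d).
Proof.
move=> mE; have mS := measurable_sphere.
rewrite (measureDI sigma mE mS) [X in (X + _)%E](_ : _ = 0%E) ?add0e//.
apply/eqP; rewrite eq_le measure_ge0 andbT; case: sigmaP => _ <- _.
by apply: le_measure; rewrite ?inE; [exact: measurableD|exact: measurableC|move=> x []].
Qed.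

(* The cells [phi @^-1` [set i]] need not be measurable: each is replaced by the
   halfspace at one of its points. *)
Lemma surface_measure_cells (I : finType) (phi : 'rV[R]_d.+1 -> I)
    (E : set (Rsp R d)) z rho : measurable E -> sphere z ->
  (forall x x', sphere x -> sphere x' -> E x -> E x' -> phi x = phi x' ->
    1 - dotp x x' <= rho) ->
  (sigma E <= #|I|%:R%:E * sigma (halfspace z rho))%E.
Proof.
move=> mE sz cells.
have /choice[rep repP] : forall i : I, exists y, sphere y /\
    forall x, sphere x -> E x -> phi x = i -> 1 - dotp y x <= rho.
  move=> i; have [[y [sy Ey yi]]|no] :=
      pselect (exists y, [/\ sphere y, E y & phi y = i]).
    by exists y; split=> // x sx Ex xi; apply: cells => //; rewrite yi xi.
  (* A cell without points is represented by [z], and its condition is vacuous. *)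
  by exists z; split=> // x sx Ex xi; exfalso; apply: no; exists x.
rewrite surface_measureIS//.
pose F k := halfspace (rep (nth (phi z) (enum I) k)) rho.
have : (sigma (E `&` @sphere R d) <= \sum_(k < #|I|) sigma (F k))%E.
  apply: (content_subadditive sigma).
  - by move=> k _; exact: measurable_halfspace.
  - exact: measurableI measurable_sphere.
  - move=> x [Ex sx]; rewrite -bigcup_mkord.
    exists (index (phi x) (enum I)); first by rewrite /= cardE index_mem mem_enum.
    by rewrite /F nth_index ?mem_enum//; exact: (repP _).2.
move=> /le_trans; apply; rewrite (eq_bigr (fun=> sigma (halfspace z rho))).
  by rewrite sumr_const card_ord mule_natl.
by move=> k _; apply: halfspace_rotation => //; exact: (repP _).1.
Qed.

End surface_measure.

Section cap_growth.
Variables (R : realType) (d : nat) (sigma : {measure set (Rsp R d) -> \bar R}).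
Hypothesis sigmaP : normalized_surface_measure sigma.
Implicit Types (x z : 'rV[R]_d.+1) (h s tau : R).

(** The rescaled points share coordinate [i] and lie in a common grid cell in the other [d]
    coordinates, so their squared distance is at most [d h ^ 2]. Radial projection only brings them
    closer. *)
Lemma chart_close i tau h (a b : R) x x' : 0 < h -> 1 <= a -> 1 <= b ->
  sphere x -> sphere x' -> a * x ord0 i = b * x' ord0 i ->
  (forall j : 'I_d, `|a * x ord0 (lift i j)| <= tau) ->
  (forall j : 'I_d, `|b * x' ord0 (lift i j)| <= tau) ->
  (forall j : 'I_d, grid_cell tau h (a * x ord0 (lift i j)) =
                    grid_cell tau h (b * x' ord0 (lift i j))) ->
  1 - dotp x x' <= d%:R * h ^+ 2 / 2.
Proof.
move=> h0 a1 b1 sx sx' xi xt x't cells.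
have := dist_radial_proj sx sx' a1 b1; rewrite (bigD1_ord i)//= xi subrr expr0n add0r.
suff : \sum_(j < d) (a * x ord0 (lift i j) - b * x' ord0 (lift i j)) ^+ 2 <=
    d%:R * h ^+ 2 by lra.
rewrite -[d in d%:R]card_ord mulr_natl -sumr_const; apply: ler_sum => j _.
exact: (grid_cell_close h0 (xt j) (x't j) (cells j)).
Qed.

(** Central projection onto the boundary of the cube: there are [2 (d + 1)] faces, given by the
    largest coordinate and its sign, each cut into at most [(2 / h + 1) ^ d] grid cells. *)
Lemma halfspace_ge_global z h : 0 < h -> sphere z ->
  (1 <= (2 * d.+1%:R * (2 / h + 1) ^+ d)%:E * sigma (halfspace z (d%:R * h ^+ 2 / 2)))%E.
Proof.
move=> h0 sz; pose imax x : 'I_d.+1 := [arg max_(i > ord0) `|x ord0 i|]%O.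
have imaxP x j : `|x ord0 j| <= `|x ord0 (imax x)|.
  by rewrite /imax; case: arg_maxP => // i _ /(_ j isT).
have imax0 x : sphere x -> 0 < `|x ord0 (imax x)|.
  rewrite /sphere/= => sx; rewrite lt_neqAle normr_ge0 andbT eq_sym.
  apply/eqP => x0; have := sx; rewrite /dotp big1 => [/esym/eqP|j _].
    by rewrite oner_eq0.
  have : `|x ord0 j| <= 0 by rewrite -x0.
  by rewrite normr_le0 => /eqP ->; rewrite mul0r.
pose phi x := (imax x, 0 < x ord0 (imax x),
  [ffun j : 'I_d => grid_cell 1 h (`|x ord0 (imax x)|^-1 * x ord0 (lift (imax x) j))]).
have mT : measurable [set: Rsp R d] by exact: measurableT.
have := surface_measure_cells sigmaP (phi := phi) mT sz.
move=> /(_ (d%:R * h ^+ 2 / 2)) H.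
case: sigmaP => <- _ _; apply: (le_trans (H _)).
  move=> x x' sx sx' _ _ [ei es] /ffunP ec.
  have inv1 y : sphere y -> 1 <= `|y ord0 (imax y)|^-1.
    by move=> sy; rewrite invf_ge1 ?imax0// sphere_coord_le1.
  have invb y j : sphere y -> `| `|y ord0 (imax y)|^-1 * y ord0 j| <= 1.
    move=> sy; rewrite normrM normfV normr_id ler_pdivrMl ?imax0// mulr1.
    exact: imaxP.
  apply: (@chart_close (imax x) 1 h `|x ord0 (imax x)|^-1 `|x' ord0 (imax x')|^-1) => //.
  - exact: inv1.
  - exact: inv1.
  (* The distinguished coordinate divided by its absolute value is its sign, which [phi] records. *)
  - rewrite -ei in es *; have := imax0 x sx; have := imax0 x' sx'; rewrite -ei !normr_gt0.
    move=> n' n; have [p|p] := boolP (0 < x ord0 (imax x)).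
      have p' : 0 < x' ord0 (imax x) by rewrite -es.
      by rewrite !gtr0_norm// !mulVf.
    have p' : ~~ (0 < x' ord0 (imax x)) by rewrite -es.
    by rewrite -!leNgt in p p'; rewrite !ler0_norm// !invrN !mulNr !mulVf.
  - by move=> j; exact: invb.
  - by move=> j; exact: invb.
  - by move=> j; have := ec j; rewrite !ffunE -ei.
rewrite lee_wpmul2r// lee_fin !card_prod card_bool card_ffun !card_ord.
rewrite natrM natrX natrM [d.+1%:R * _]mulrC.
rewrite ler_wpM2l ?mulr_ge0// lerXn2r ?nnegrE//; last first.
  by have := @grid_size_le R 1 h ler01 h0; rewrite mulr1.
by rewrite addr_ge0// divr_ge0// ltW.
Qed.

(** The left side is a cap of chordal radius [s]. For [s >= 1] the global count suffices. For
    [s < 1] the cap is rotated to the first basis vector [e] and projected centrally to the tangent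
    plane [x_0 = 1], where a grid on a cube of half-width [2 s] covers it. *)
Lemma halfspace_growth z h s : 0 < h -> 0 < s -> sphere z ->
  (sigma (halfspace z (s ^+ 2 / 2)) <=
   (2 * d.+1%:R * (4 * s / h + 1) ^+ d)%:E * sigma (halfspace z (d%:R * h ^+ 2 / 2)))%E.
Proof.
move=> h0 s0 sz; have [s1|s1] := leP 1 s.
  apply: (@le_trans _ _ 1%E).
    case: (sigmaP) => <- _ _; apply: le_measure; rewrite ?inE//.
    exact: measurable_halfspace.
  apply: (le_trans (halfspace_ge_global h0 sz)).
  rewrite lee_wpmul2r// lee_fin ler_wpM2l ?mulr_ge0// lerXn2r// ?nnegrE ?addr_ge0//
    ?divr_ge0 ?mulr_ge0 ?(ltW h0) ?(ltW s0)//.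
  by rewrite lerD2r ler_pM2r ?invr_gt0//; lra.
pose e : 'rV[R]_d.+1 := delta_mx ord0 ord0.
have de x : dotp e x = x ord0 ord0.
  rewrite /dotp big_ord_recl mxE !eqxx mul1r big1 ?addr0// => j _.
  by rewrite mxE eqxx/= mul0r.
have se : sphere e by rewrite /sphere/= de mxE !eqxx.
rewrite (halfspace_rotation sigmaP _ sz se).
pose phi x := [ffun j : 'I_d => grid_cell (2 * s) h
  ((x ord0 ord0)^-1 * x ord0 (lift ord0 j))].
have mE := measurable_halfspace e (s ^+ 2 / 2).
apply: (le_trans (surface_measure_cells sigmaP (phi := phi) mE sz
  (rho := d%:R * h ^+ 2 / 2) _)).
  have x0 y : halfspace e (s ^+ 2 / 2) y -> 1 / 2 <= y ord0 ord0.
    by rewrite /halfspace/= de; nra.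
  have inv1 y : sphere y -> halfspace e (s ^+ 2 / 2) y -> 1 <= (y ord0 ord0)^-1.
    move=> sy /x0 y0; have y00 : 0 < y ord0 ord0 by lra.
    rewrite invf_ge1//.
    by apply: le_trans (sphere_coord_le1 ord0 sy); exact: ler_norm.
  have invb y j : sphere y -> halfspace e (s ^+ 2 / 2) y -> j != ord0 ->
      `|(y ord0 ord0)^-1 * y ord0 j| <= 2 * s.
    move=> sy hy j0; have y0 := x0 _ hy; have y00 : 0 < y ord0 ord0 by lra.
    rewrite normrM gtr0_norm ?invr_gt0// ler_pdivrMl//.
    (* Here [y_0 >= 1 / 2], and [y_j ^ 2 <= 1 - y_0 ^ 2 <= 2 (1 - y_0) <= s ^ 2]. *)
    suff : `|y ord0 j| <= s by move=> /le_trans; apply; nra.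
    have : y ord0 j ^+ 2 + y ord0 ord0 ^+ 2 <= 1.
      rewrite -(sy : dotp y y = 1) /dotp (bigD1 ord0)//= (bigD1 j)//= addrA.
      rewrite -!expr2 [leLHS]addrC lerDl sumr_ge0// => k _; exact: sqr_ge0.
    move: hy; rewrite /halfspace/= de => hy sq.
    rewrite -(@ler_pXn2r _ 2%N) ?nnegrE ?(ltW s0)// real_normK ?num_real//.
    by nra.
  move=> x x' sx sx' Ex Ex' /ffunP ec.
  apply: (@chart_close ord0 (2 * s) h (x ord0 ord0)^-1 (x' ord0 ord0)^-1) => //.
  - exact: inv1.
  - exact: inv1.
  - by have := x0 _ Ex; have := x0 _ Ex' => p' p; rewrite !mulVf// gt_eqF//; lra.
  - by move=> j; exact: invb.
  - by move=> j; exact: invb.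
  - by move=> j; have := ec j; rewrite !ffunE.
rewrite lee_wpmul2r// lee_fin card_ffun !card_ord natrX.
apply: (@le_trans _ _ (1 * (4 * s / h + 1) ^+ d)).
  rewrite mul1r lerXn2r ?nnegrE//.
    by rewrite addr_ge0// divr_ge0 ?(ltW h0)// mulr_ge0// ltW.
  have := @grid_size_le R (2 * s) h; rewrite mulrA -natrM; apply => //.
  by rewrite mulr_ge0// ltW.
rewrite ler_wpM2r ?exprn_ge0 ?addr_ge0 ?divr_ge0 ?(ltW h0) ?mulr_ge0 ?(ltW s0)//.
by rewrite -natrM ler1n.
Qed.

End cap_growth.

(** * Real estimates for the dyadic sum *)

Section real_estimates.
Variable R : realType.

Lemma bernoulli_sub (c : R) n : 0 <= c <= 1 -> 1 - n%:R * c <= (1 - c) ^+ n.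
Proof.
move=> /andP[c0 c1]; elim: n => [|n IH]; first by rewrite mul0r subr0 expr0.
rewrite exprS -natr1; have p : 0 <= 1 - c by lra.
apply: le_trans (ler_wpM2l p IH).
have : 0 <= n%:R * c ^+ 2 by rewrite mulr_ge0// sqr_ge0.
by nra.
Qed.

Lemma two_succ_le_exp4 d : (1 <= d)%N -> 2 * d.+1%:R <= 4 ^+ d :> R.
Proof.
case: d => // d _; rewrite -natrM -natrX ler_nat.
by elim: d => // d IH; rewrite expnS; lia.
Qed.

Lemma geometric_half_le2 n : \sum_(j < n) (2 ^+ j)^-1 <= 2 :> R.
Proof.
suff -> : \sum_(j < n) (2 ^+ j)^-1 = 2 - 2 * (2 ^+ n)^-1 :> R.
  by rewrite gerBl mulr_ge0// invr_ge0 exprn_ge0.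
elim: n => [|n IH]; first by rewrite big_ord0 expr0 invr1 mulr1 subrr.
rewrite big_ord_recr/= IH exprS; field.
by rewrite expf_neq0.
Qed.

(** Take the least [j] with [u <= 4 ^ (j + 1) w]. If [j = 0] then [G <= 1] is enough; otherwise
    [u > 4 ^ j w], so [G <= (w / u) ^ d <= 4 ^ (- j d)]. The bound on [u] in terms of [J] makes such
    a [j] exist within the sum. *)
Lemma dyadic_majorant d J (w u G : R) : 0 < w -> 0 <= G <= 1 ->
  G * u ^+ d <= w ^+ d -> u <= 4 ^+ J.+1 * w ->
  G <= \sum_(j < J.+1) (4 ^+ j)^-1 ^+ d * (u <= 4 ^+ j.+1 * w)%R%:R.
Proof.
move=> w0 /andP[G0 G1] Gu uJ.
have [j uj jmin] := ex_minnP (ex_intro (fun j => u <= 4 ^+ j.+1 * w) J uJ).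
have jJ : (j < J.+1)%N by rewrite ltnS jmin.
rewrite (bigD1 (Ordinal jJ))//= uj mulr1 ler_wpDr//.
  by apply: sumr_ge0 => i _; rewrite mulr_ge0// exprn_ge0// invr_ge0 exprn_ge0.
case: j uj jmin jJ => [|j] uj jmin jJ; first by rewrite expr0 invr1 expr1n.
have {}uj : 4 ^+ j.+1 * w < u.
  by rewrite ltNge; apply/negP => /jmin; rewrite ltnn.
rewrite exprVn -[leRHS]mul1r ler_pdivlMr ?exprn_gt0//.
rewrite -(ler_pM2r (exprn_gt0 d w0)) mul1r; apply: le_trans Gu.
rewrite -mulrA -exprMn ler_wpM2l// lerXn2r ?nnegrE//; last exact: ltW.
  by rewrite mulr_ge0 ?exprn_ge0// ltW.
by apply: le_trans (ltW uj); rewrite mulr_ge0 ?exprn_ge0// ltW.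
Qed.

(** The weight of layer [j] times the factor of [halfspace_growth] for [s = 2 ^ (j + 2) / (2 n + 1)]
    and [h = 1 / (3 n d)]. That factor is at most [4 ^ d (25 * 2 ^ j d) ^ d], so the weight
    [4 ^ (- j d)] leaves [2 ^ (- j d) <= 2 ^ (- j)]. *)
Lemma layer_bound n d j : (1 <= n)%N -> (1 <= d)%N ->
  (4 ^+ j)^-1 ^+ d * (2 * d.+1%:R *
    (4 * (2 ^+ j.+2 / n.*2.+1%:R) / (3 * n%:R * d%:R)^-1 + 1) ^+ d) <=
  (100 * d%:R) ^+ d * (2 ^+ j)^-1 :> R.
Proof.
move=> n1 d1; have n0 : 1 <= n%:R :> R by rewrite ler1n.
have d0 : 1 <= d%:R :> R by rewrite ler1n.
have mE : n.*2.+1%:R = 2 * n%:R + 1 :> R by rewrite -natr1 -muln2 natrM mulrC.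
have j0 : 1 <= 2 ^+ j :> R by rewrite exprn_ege1// ler1n.
have m0 : 0 < n.*2.+1%:R :> R by rewrite ltr0n.
have -> : 4 ^+ j = 2 ^+ j * 2 ^+ j :> R by rewrite -exprMn; congr (_ ^+ _); ring.
have jd : 1 <= 2 ^+ j * d%:R :> R by rewrite mulr_ege1.
have step : 4 * (2 ^+ j.+2 / n.*2.+1%:R) / (3 * n%:R * d%:R)^-1 + 1 <=
    25 * (2 ^+ j * d%:R) :> R.
  rewrite invrK 2!exprS.
  have -> : 4 * (2 * (2 * 2 ^+ j) / n.*2.+1%:R) * (3 * n%:R * d%:R) =
      24 * (2 ^+ j * d%:R) * (2 * n%:R / n.*2.+1%:R) :> R.
    by field; rewrite gt_eqF.
  have : 2 * n%:R / n.*2.+1%:R <= 1 :> R by rewrite ler_pdivrMr// mul1r mE lerDl.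
  move: (2 * n%:R / n.*2.+1%:R : R) (2 ^+ j * d%:R : R) jd => A B B1 A1; nra.
have pos : 0 <= 4 * (2 ^+ j.+2 / n.*2.+1%:R) / (3 * n%:R * d%:R)^-1 + 1 :> R.
  by rewrite invrK addr_ge0// !mulr_ge0// ?exprn_ge0// invr_ge0 ltW.
apply: (@le_trans _ _ ((2 ^+ j * 2 ^+ j)^-1 ^+ d * (4 ^+ d * (25 * (2 ^+ j * d%:R)) ^+ d))).
  rewrite ler_wpM2l ?exprn_ge0 ?invr_ge0 ?mulr_ge0 ?exprn_ge0//.
  rewrite ler_pM ?mulr_ge0 ?exprn_ge0 ?two_succ_le_exp4//.
  by rewrite lerXn2r// nnegrE mulr_ge0// (le_trans ler01).
rewrite -[4 ^+ d * _]exprMn -[_ ^+ d * _ ^+ d]exprMn.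
have -> : (2 ^+ j * 2 ^+ j)^-1 * (4 * (25 * (2 ^+ j * d%:R))) = 100 * d%:R * (2 ^+ j)^-1 :> R.
  by field; rewrite gt_eqF ?(lt_le_trans ltr01).
rewrite exprMn ler_wpM2l ?exprn_ge0 ?mulr_ge0//.
case: d d1 {d0 jd step pos} => // d _; rewrite exprS ler_piMr ?invr_ge0 ?exprn_ge0//.
by rewrite exprn_ile1 ?invr_ge0 ?exprn_ge0// invf_le1 ?(lt_le_trans ltr01).
Qed.

End real_estimates.

(** * Zonal integrals *)

Section zonal_integrals.
Variables (R : realType) (d : nat).
Implicit Types (z : 'rV[R]_d.+1) (nu sigma : {measure set (Rsp R d) -> \bar R}).

Lemma le_integral_on_sphere nu (f1 f2 : Rsp R d -> R) :
  nu (~` @sphere R d) = 0%E ->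
  measurable_fun setT f1 -> measurable_fun setT f2 ->
  (forall x, 0 <= f1 x) -> (forall x, 0 <= f2 x) ->
  (forall x, sphere x -> f1 x <= f2 x) ->
  (\int[nu]_x (f1 x)%:E <= \int[nu]_x (f2 x)%:E)%E.
Proof.
move=> nu0 m1 m2 f10 f20 f12; apply: ae_ge0_le_integral => //.
- by move=> x _; rewrite lee_fin.
- exact/measurable_EFinP.
- by move=> x _; rewrite lee_fin.
- exact/measurable_EFinP.
- exists (~` @sphere R d); split => //; first by apply: measurableC; exact: measurable_sphere.
  by move=> x /= h sx; apply: h => _; rewrite lee_fin f12.
Qed.

Lemma measurable_scaled_indic (c : R) (E : set (Rsp R d)) : measurable E ->
  measurable_fun setT (fun x => c * \1_E x).
Proof.
by move=> mE; apply: measurable_funM => //; exact: measurable_indic.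
Qed.

Lemma integral_scaled_indic nu (c : R) (E : set (Rsp R d)) : 0 <= c ->
  measurable E -> (\int[nu]_x (c * \1_E x)%:E = c%:E * nu E)%E.
Proof.
move=> c0 mE; under eq_integral do rewrite EFinM.
rewrite ge0_integralZl//; first by rewrite integral_indic// setIT.
by apply/measurable_EFinP; exact: measurable_indic.
Qed.

Variable sigma : {measure set (Rsp R d) -> \bar R}.
Hypothesis sigmaP : normalized_surface_measure sigma.

Lemma surface_measure_fin_num (E : set (Rsp R d)) : measurable E ->
  sigma E \is a fin_num.
Proof.
move=> mE; rewrite ge0_fin_numE//; apply: (@le_lt_trans _ _ 1%E); last exact: ltry.
by case: sigmaP => <- _ _; apply: le_measure; rewrite ?inE.
Qed.

(** With [u = 1 - dotp z x], the integrand is at most [min (1, (w / u) ^ d)], which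
    [dyadic_majorant] bounds by weighted indicators of caps. Each layer costs a multiple [2 ^ (- j)]
    of the measure of the small cap, and the series sums to at most 2. *)
Lemma integral_peak_le n z (p : {poly R}) : (1 <= n)%N -> (1 <= d)%N -> sphere z ->
  (forall s, -1 <= s <= 1 ->
    `|p.[s]| <= 1 /\ p.[s] ^+ 2 * (1 - s) <= 2 / n.*2.+1%:R ^+ 2) ->
  (sqnorm sigma (fun x => (p ^+ d).[dotp z x]) <=
   (2 * (100 * d%:R) ^+ d)%:E *
   sigma (halfspace z (d%:R * (3 * n%:R * d%:R)^-1 ^+ 2 / 2)))%E.
Proof.
move=> n1 d1 sz hp; set h := (3 * n%:R * d%:R)^-1.
have h0 : 0 < h by rewrite invr_gt0 !mulr_gt0// ltr0n.
set m : R := n.*2.+1%:R; pose w := 2 / m ^+ 2.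
have m0 : 0 < m by rewrite ltr0n.
have w0 : 0 < w by rewrite divr_gt0// exprn_gt0.
(* Large enough for the last layer to contain the sphere: [2 ^ m >= m] gives
   [4 ^ (J + 1) w >= 2 >= u]. *)
pose J := n.*2.+1.
pose E j := halfspace z (4 ^+ j.+1 * w).
pose c j : R := (4 ^+ j)^-1 ^+ d.
have c0 j : 0 <= c j by rewrite exprn_ge0// invr_ge0 exprn_ge0.
have mE j : measurable (E j) by exact: measurable_halfspace.
have layer_ge0 j x : 0 <= c j * \1_(E j) x by rewrite mulr_ge0.
case: (sigmaP) => _ sigma0 _.
apply: (@le_trans _ _ (\int[sigma]_x (\sum_(j < J.+1) c j * \1_(E j) x)%:E)%E).
  rewrite /sqnorm; apply: le_integral_on_sphere => //.
  - by apply: measurable_funX; exact: measurable_zonal.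
  - by apply: measurable_sum => j; exact: measurable_scaled_indic.
  - by move=> x; exact: sqr_ge0.
  - by move=> x; exact: sumr_ge0.
  - move=> x sx; have s1 : -1 <= dotp z x <= 1.
      by rewrite dotp_geN1 ?dotp_le1.
    have [p1 pw] := hp _ s1; rewrite horner_exp -exprM mulnC exprM.
    have indE j : \1_(E j) x = (1 - dotp z x <= 4 ^+ j.+1 * w)%R%:R :> R.
      by rewrite indicE; congr (nat_of_bool _)%:R; apply/idP/idP => [/set_mem|/mem_set].
    under eq_bigr do rewrite indE.
    have P0 := sqr_ge0 p.[dotp z x].
    have u0 : 0 <= 1 - dotp z x by lra.
    apply: dyadic_majorant => //.
    + rewrite exprn_ge0//= exprn_ile1// -real_normK ?num_real//.
      by rewrite exprn_ile1.
    + by rewrite -exprMn lerXn2r// nnegrE ?(ltW w0)// mulr_ge0.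
    + apply: (@le_trans _ _ 2); first by lra.
      rewrite /w mulrCA -[leLHS]mulr1 ler_pM2l// ler_pdivlMr ?exprn_gt0// mul1r.
      rewrite [4 ^+ _]exprS; apply: (@le_trans _ _ (4 ^+ J));
        last by rewrite ler_peMl ?exprn_ge0// ler1n.
      have -> : 4 ^+ J = (2 ^+ J) ^+ 2 :> R by rewrite exprAC; congr (_ ^+ _); ring.
      by rewrite lerXn2r ?nnegrE ?exprn_ge0// -natrX ler_nat ltnW// ltn_expl.
under eq_integral do rewrite -sumEFin.
rewrite ge0_integral_sum//; last 2 first.
- by move=> j; apply/measurable_EFinP; exact: measurable_scaled_indic.
- by move=> j x _; rewrite lee_fin.
set b := sigma (halfspace z _).
have bfin : b \is a fin_num.
  exact: surface_measure_fin_num (measurable_halfspace _ _).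
have b0 : 0 <= fine b by rewrite fine_ge0// measure_ge0.
rewrite -[b]fineK//.
apply: (@le_trans _ _ (\sum_(j < J.+1) ((100 * d%:R) ^+ d * (2 ^+ j)^-1 * fine b)%:E)%E).
  apply: lee_sum => j _; rewrite integral_scaled_indic//.
  have s0 : 0 < 2 ^+ j.+2 / m by rewrite divr_gt0// exprn_gt0.
  have := halfspace_growth sigmaP h0 s0 sz.
  have -> : (2 ^+ j.+2 / m) ^+ 2 / 2 = 4 ^+ j.+1 * w.
    have -> : 4 ^+ j.+1 = (2 ^+ j.+1) ^+ 2 :> R by rewrite exprAC; congr (_ ^+ _); ring.
    by rewrite /w [2 ^+ j.+2]exprS; field; rewrite gt_eqF.
  move=> H; apply: (le_trans (lee_wpmul2l _ H)); first by rewrite lee_fin.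
  rewrite muleA -EFinM -/b -[b in leLHS]fineK// -EFinM lee_fin ler_wpM2r//.
  exact: layer_bound.
rewrite sumEFin -EFinM lee_fin -mulr_suml ler_wpM2r// -mulr_sumr mulrC.
by rewrite ler_wpM2r ?exprn_ge0 ?mulr_ge0// geometric_half_le2.
Qed.

(** On the small cap [c = n ^ 2 (1 - dotp z x)] satisfies [d c <= 1 / 18], so Bernoulli gives
    [p ^ (8 d) >= 1 - 8 d c >= 5 / 9]. *)
Lemma integral_peak_ge n z (p : {poly R}) : (1 <= n)%N -> (1 <= d)%N -> sphere z ->
  (forall s, -1 <= s <= 1 -> 1 - n%:R ^+ 2 * (1 - s) <= p.[s]) ->
  ((1 / 2)%:E * sigma (halfspace z (d%:R * (3 * n%:R * d%:R)^-1 ^+ 2 / 2)) <=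
   sqnorm sigma (fun x => (p ^+ (4 * d)).[dotp z x]))%E.
Proof.
move=> n1 d1 sz hp; set B := halfspace z _.
have mB : measurable B by exact: measurable_halfspace.
have half0 : 0 <= 1 / 2 :> R by lra.
rewrite -integral_scaled_indic//; case: (sigmaP) => _ sigma0 _.
rewrite /sqnorm; apply: le_integral_on_sphere => //.
- exact: measurable_scaled_indic.
- by apply: measurable_funX; exact: measurable_zonal.
- by move=> x; exact: sqr_ge0.
move=> x sx; have s1 : -1 <= dotp z x <= 1 by rewrite dotp_geN1 ?dotp_le1.
rewrite indicE; case: (boolP (x \in B)) => [/set_mem|_]; last first.
  by rewrite mulr0 sqr_ge0.
rewrite /B /halfspace/= mulr1 => ux.
have n0 : 1 <= n%:R :> R by rewrite ler1n.
have d0 : 1 <= d%:R :> R by rewrite ler1n.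
set c := n%:R ^+ 2 * (1 - dotp z x).
have c0 : 0 <= c by rewrite mulr_ge0 ?sqr_ge0//; lra.
have c1 : d%:R * c <= 1 / 18.
  have : d%:R * c <= d%:R * (n%:R ^+ 2 * (d%:R * (3 * n%:R * d%:R)^-1 ^+ 2 / 2)).
    by rewrite ler_wpM2l// ler_wpM2l// sqr_ge0.
  move=> /le_trans; apply; rewrite le_eqVlt; apply/orP; left; apply/eqP.
  by field; rewrite !gt_eqF ?(lt_le_trans ltr01).
have c2 : c <= 1 by nra.
rewrite horner_exp -exprM.
apply: (@le_trans _ _ ((1 - c) ^+ (4 * d * 2))).
  apply: le_trans (bernoulli_sub _ _); last by rewrite c0.
  by rewrite !natrM; lra.
by rewrite lerXn2r ?nnegrE ?hp//; [lra|apply: le_trans (hp _ s1); rewrite -/c; lra].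
Qed.

End zonal_integrals.

(** * The tail bound and the conclusion *)

(** Makes the off-cap error absorbable; [3 d] is the gap between the exponents [4 d] and [d] of the
    two peaks. Since [kap <= kap ^ d] and [4 <= 4 ^ d], it suffices that [U ^ 3 >= 400 d kap], where
    [U] is the inverse of the base of the power. *)
Lemma tail_constant (R : realType) (d n : nat) (kap r : R) : (1 <= d)%N ->
  1 <= kap -> 10 / 7 * (d%:R + 4) * kap <= n%:R * r -> 0 <= r <= pi ->
  kap * (2 / n.*2.+1%:R ^+ 2 / (1 - cos r)) ^+ (3 * d) * (4 * (100 * d%:R) ^+ d) <= 1.
Proof.
move=> d1 k1 nr rpi; have d0 : 1 <= d%:R :> R by rewrite ler1n.
have mE : n.*2.+1%:R = 2 * n%:R + 1 :> R by rewrite -natr1 -muln2 natrM mulrC.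
have m0 : 0 < n.*2.+1%:R :> R by rewrite ltr0n.
have n0 : 0 <= n%:R :> R by [].
have u0 := one_sub_cos_ge rpi; case/andP: rpi => r0 _.
pose D : R := (d%:R + 4) ^+ 2.
have D25 : 25 <= D by rewrite /D; nra.
have Dd : 16 * d%:R <= D by rewrite /D; have := sqr_ge0 (d%:R - 4 : R); nra.
pose U := n.*2.+1%:R ^+ 2 * (1 - cos r) / 2.
(* [U >= 25 / 144 (n r) ^ 2], and [25 / 144 * (10 / 7) ^ 2] exceeds [35 / 100]. *)
have UD : 35 / 100 * D * kap <= U.
  have h1 : (10 / 7 * (d%:R + 4) * kap) ^+ 2 <= (n%:R * r) ^+ 2.
    by rewrite lerXn2r// ?nnegrE !mulr_ge0//; lra.
  have h2 : 25 / 144 * (n%:R * r) ^+ 2 <= U.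
    have : n%:R ^+ 2 * (25 / 288 * r ^+ 2) <= n%:R ^+ 2 * (1 - cos r).
      by rewrite ler_wpM2l// sqr_ge0.
    have : (2 * n%:R) ^+ 2 * (1 - cos r) <= n.*2.+1%:R ^+ 2 * (1 - cos r).
      apply: ler_wpM2r; last by rewrite lerXn2r ?nnegrE ?mulr_ge0// mE; lra.
      by rewrite subr_ge0 cos_le1.
    by rewrite /U !exprMn; lra.
  have h3 : D * kap <= D * kap ^+ 2 by rewrite ler_wpM2l//; [lra|nra].
  have -> : (35 / 100 * D * kap) = 35 / 100 * (D * kap) by ring.
  have : (10 / 7 * (d%:R + 4) * kap) ^+ 2 = 100 / 49 * (D * kap ^+ 2) by rewrite /D; field.
  have : 0 <= D * kap by nra.
  lra.
have Dk : 25 <= D * kap by nra.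
have U0 : 0 < U by lra.
have UV : 2 / n.*2.+1%:R ^+ 2 / (1 - cos r) = U^-1.
  have : 1 - cos r != 0 by apply/eqP => c0; move: U0; rewrite /U c0 mulr0 mul0r ltxx.
  by move=> c0; rewrite /U; field; rewrite c0 gt_eqF.
(* From [D >= 25] and [D >= 16 d]: two factors [U >= 35 / 4] and one factor [U >= 5.6 d kap]. *)
have U3 : 400 * d%:R * kap <= U ^+ 3.
  have e1 : 35 / 4 <= U by lra.
  have e2 : 56 / 10 * d%:R * kap <= U by nra.
  have e3 : (35 / 4) ^+ 2 <= U ^+ 2 by rewrite lerXn2r ?nnegrE//; lra.
  rewrite exprSr.
  have dk : 0 <= d%:R * kap by nra.
  have : (35 / 4) ^+ 2 * (56 / 10 * d%:R * kap) <= U ^+ 2 * U.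
    by apply: ler_pM => //; nra.
  by nra.
have key : (400 * d%:R * kap * U ^- 3) ^+ d <= 1.
  have pos : 0 <= 400 * d%:R * kap by rewrite !mulr_ge0 ?ler0n// (le_trans ler01).
  apply: exprn_ile1; first exact: divr_ge0 pos (exprn_ge0 _ (ltW U0)).
  by rewrite ler_pdivrMr ?exprn_gt0// mul1r.
apply: le_trans key; rewrite UV.
have -> : (400 * d%:R * kap * U ^- 3) ^+ d =
    kap ^+ d * U^-1 ^+ (3 * d) * (4 ^+ d * (100 * d%:R) ^+ d).
  rewrite exprM exprVn -!exprMn; congr (_ ^+ _); ring.
have kd : kap <= kap ^+ d by rewrite ler_eXnr.
have fd : 4 <= 4 ^+ d :> R by rewrite ler_eXnr// ler1n.
have pU : 0 <= U^-1 ^+ (3 * d) by rewrite exprn_ge0// invr_ge0 ltW.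
have pd : 0 <= (100 * d%:R) ^+ d :> R by rewrite exprn_ge0// mulr_ge0.
by rewrite ler_pM ?mulr_ge0 ?ler_wpM2r//; lra.
Qed.

Lemma sqnorm_split (R : realType) (d : nat) (mu : {measure set (Rsp R d) -> \bar R})
    (f g : 'rV[R]_d.+1 -> R) (q : R) (z : 'rV[R]_d.+1) (r : R) :
  mu (~` @sphere R d) = 0%E -> 0 <= q ->
  measurable_fun setT (f : Rsp R d -> R) -> measurable_fun setT (g : Rsp R d -> R) ->
  (forall x, cap z r x -> f x ^+ 2 <= 1) ->
  (forall x, sphere x -> dotp z x < cos r -> f x ^+ 2 <= q * g x ^+ 2) ->
  (sqnorm mu f <= mu (cap z r) + q%:E * sqnorm mu g)%E.
Proof.
move=> mu0 q0 mf mg fcap ftail.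
have mC := measurable_cap z r.
have mf2 : measurable_fun setT (fun x : Rsp R d => f x ^+ 2) by exact: measurable_funX.
have mg2 : measurable_fun setT (fun x : Rsp R d => g x ^+ 2) by exact: measurable_funX.
have mqg : measurable_fun setT (fun x : Rsp R d => q * g x ^+ 2).
  exact: measurable_funM.
have qg0 x : 0 <= q * g x ^+ 2 by rewrite mulr_ge0// sqr_ge0.
apply: (@le_trans _ _ (\int[mu]_x (\1_(@cap R d z r : set (Rsp R d)) x + q * g x ^+ 2)%:E)%E).
  apply: le_integral_on_sphere => //.
  - by apply: measurable_funD => //; exact: measurable_indic.
  - by move=> x; exact: sqr_ge0.
  - by move=> x; rewrite addr_ge0.
  move=> x sx; rewrite indicE; case: (boolP (x \in _)) => [/set_mem /fcap fx|xC].
    by rewrite (le_trans fx)// lerDl.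
  rewrite add0r; apply: ftail => //; rewrite ltNge; apply/negP => h.
  by move/negP: xC; apply; apply/mem_set; split.
under eq_integral do rewrite EFinD.
rewrite ge0_integralD//; last 3 first.
- by apply/measurable_EFinP; exact: measurable_indic.
- by move=> x _; rewrite lee_fin.
- exact/measurable_EFinP.
rewrite integral_indic// setIT leeD2l//.
under eq_integral do rewrite EFinM.
rewrite ge0_integralZl//; first exact/measurable_EFinP.
by move=> x _; rewrite lee_fin sqr_ge0.
Qed.

Theorem theorem7p2 (R : realType) (d t : nat) (eps a A : R)
  (sigma mu : {measure set (Rsp R d) -> \bar R}) :
  (1 <= d)%N -> (1 <= t)%N ->
  0 < eps < 1 -> 0 < a -> a <= A ->
  normalized_surface_measure sigma ->
  finite_measure_on_sphere mu ->
  MZ t sigma mu a A ->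
  forall (r : R) (z : 'rV[R]_(d.+1)),
    V_d d a A eps / t%:R <= r -> r <= pi -> sphere z ->
    (mu (cap z r) >= (a * eps / (dimPi d t)%:R)%:E)%E.
Proof.
move=> d1 t1 eps01 a0 aA sigmaP [_ mu0] MZt r z Vr rpi sz.
have VdE := V_d_ge d1 eps01 a0 aA; case/andP: eps01 => e0 e1.
pose kap := A / a / (1 - eps); rewrite -/kap in VdE.
have k1 : 1 <= kap.
  rewrite ler_pdivlMr ?subr_gt0// mul1r (@le_trans _ _ 1)//; first by lra.
  by rewrite ler_pdivlMr// mul1r.
have d0 : 1 <= d%:R :> R by rewrite ler1n.
have t0 : 0 < t%:R :> R by rewrite ltr0n.
have tr : 80 * d%:R ^+ 2 * (d%:R + 4) * kap <= r * t%:R.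
  by apply: le_trans VdE _; rewrite -ler_pdivrMr.
have d2 : 1 <= d%:R ^+ 2 :> R by rewrite exprn_ege1.
have trd : 400 * d%:R ^+ 2 <= r * t%:R.
  apply: le_trans tr.
  have : 5 <= (d%:R + 4) * kap by nra.
  by rewrite -(mulrA (80 * _)); move: ((d%:R + 4) * kap) => y y5; nra.
have r0 : 0 < r by rewrite -(pmulr_lgt0 _ t0); lra.
(* [r <= pi < 4] forces [t] to be large, so that [n] below is at least 1. *)
have t100 : 100 * d%:R ^+ 2 <= t%:R :> R.
  have : r * t%:R <= 4 * t%:R by rewrite ler_wpM2r ?ltW//; have := @pihalf_lt2 R; lra.
  lra.
(* The factor [28 d ^ 2] keeps the degree [4 d n] of [f] below [t] and also gives
   [(28 n d) ^ d <= (t / d) ^ d], used to compare the covering count with [dimPi]. As [n >= 1],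
   rounding loses at most a factor 2, whence [56] and [80 / 56 = 10 / 7]. *)
pose n := (t %/ (28 * d ^ 2))%N.
have nt : (n * (28 * d ^ 2) <= t)%N by exact: leq_trunc_div.
have n1 : (1 <= n)%N.
  rewrite divn_gt0 ?muln_gt0 ?expn_gt0 ?d1// -(ler_nat R) natrM natrX; lra.
have tn : t%:R <= 56 * n%:R * d%:R ^+ 2 :> R.
  have : (t < n.+1 * (28 * d ^ 2))%N by rewrite ltn_ceil// muln_gt0 expn_gt0 d1.
  have : (n.+1 * (28 * d ^ 2) <= 2 * n * (28 * d ^ 2))%N.
    by rewrite leq_mul2r mul2n -addnn -[n.+1]addn1 leq_add2l n1 orbT.
  move=> h /ltnW/leq_trans/(_ h); rewrite -(ler_nat R) 3!natrM natrX => /le_trans; apply.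
  by rewrite le_eqVlt; apply/orP; left; apply/eqP; ring.
have nr : 10 / 7 * (d%:R + 4) * kap <= n%:R * r.
  have : r * t%:R <= r * (56 * n%:R * d%:R ^+ 2) by rewrite ler_wpM2l// ltW.
  move=> /(le_trans tr) h.
  rewrite -(@ler_pM2r _ (56 * d%:R ^+ 2)); last by lra.
  by apply: le_trans (le_trans _ h) _; rewrite le_eqVlt; apply/orP; left; apply/eqP; field.
have r0pi : 0 <= r <= pi by rewrite ltW.
have tail := tail_constant d1 k1 nr r0pi.
have [p [sp pP]] := peak_poly R n.
pose f x := (p ^+ (4 * d)).[dotp z x]; pose g x := (p ^+ d).[dotp z x].
have deg k : (k <= 4 * d)%N -> (size (p ^+ k) <= t.+1)%N.
  move=> kd; rewrite (leq_trans (size_poly_exp_leq _ _))// ltnS (leq_trans _ nt)//.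
  have : ((size p).-1 <= n)%N by case: (size p) sp.
  move=> h; apply: leq_trans (leq_mul h kd) _.
  by rewrite leq_mul2l leq_mul ?orbT// expnS leq_pmulr// expn_gt0 d1.
have Pf : Pi t f by apply: Pi_zonal; exact: deg.
have Pg : Pi t g by apply: Pi_zonal; apply: deg; rewrite leq_pmull.
set w := 2 / n.*2.+1%:R ^+ 2 in tail.
set q := (w / (1 - cos r)) ^+ (3 * d) in tail.
have w0 : 0 <= w by rewrite divr_ge0// sqr_ge0.
have q0 : 0 <= q by rewrite exprn_ge0// divr_ge0// subr_ge0 cos_le1.
have tailf : (sqnorm mu f <= mu (cap z r) + q%:E * sqnorm mu g)%E.
  apply: sqnorm_split => //; [exact: measurable_zonal|exact: measurable_zonal| |].
    move=> x [sx _]; have s1 : -1 <= dotp z x <= 1 by rewrite dotp_geN1 ?dotp_le1.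
    have [p1 _ _] := pP _ s1; rewrite -real_normK ?num_real// /f horner_exp normrX.
    by rewrite !exprn_ile1 ?exprn_ge0.
  move=> x sx sr; have s1 : -1 <= dotp z x <= 1 by rewrite dotp_geN1 ?dotp_le1.
  have [_ pw _] := pP _ s1; have s2 : 0 < 1 - cos r.
    by apply: lt_le_trans (one_sub_cos_ge r0pi); rewrite mulr_gt0 ?exprn_gt0//; lra.
  rewrite /f /g !horner_exp.
  set P := p.[dotp z x] in pw *; have P0 : 0 <= P ^+ 2 by exact: sqr_ge0.
  have sqE k : (P ^+ k) ^+ 2 = (P ^+ 2) ^+ k by exact: exprAC.
  (* Of the [4 d] factors [P ^ 2], [d] make up [g ^ 2]; each of the other [3 d] is at most
     [w / (1 - cos r)] off the cap. *)
  rewrite !sqE -[(4 * d)%N]/(3.+1 * d)%N mulSnr exprD.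
  apply: ler_wpM2r; first exact: exprn_ge0.
  rewrite /q lerXn2r// ?nnegrE ?divr_ge0 ?(ltW s2)// ler_pdivlMr//.
  by apply: le_trans pw; rewrite ler_wpM2l//; lra.
set h : R := (3 * n%:R * d%:R)^-1; pose B := halfspace z (d%:R * h ^+ 2 / 2).
have n0 : 1 <= n%:R :> R by rewrite ler1n.
have h0 : 0 < h by rewrite invr_gt0 !mulr_gt0//; lra.
have Bfin : sigma B \is a fin_num.
  by apply: surface_measure_fin_num => //; exact: measurable_halfspace.
set b := fine (sigma B); have bE : sigma B = b%:E by rewrite fineK.
have b0 : 0 <= b by rewrite fine_ge0// measure_ge0.
have lo : ((b / 2)%:E <= sqnorm sigma f)%E.
  have := @integral_peak_ge R d sigma sigmaP n z p n1 d1 sz.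
  rewrite -/h -/B bE -EFinM mul1r mulrC; apply.
  by move=> s /pP[].
have up : (sqnorm sigma g <= (2 * (100 * d%:R) ^+ d * b)%:E)%E.
  rewrite EFinM -bE; apply: integral_peak_le => //.
  by move=> s /pP[].
(* The covering count is [2 (d + 1) (6 n d + 1) ^ d <= 4 ^ d (7 n d) ^ d = (28 n d) ^ d], hence at
   most [dimPi / 2]. *)
have dimb : 2 / (dimPi d t)%:R <= b.
  have dim2 := dimPi_ge R d1 t1.
  have dim0 : 0 < (dimPi d t)%:R :> R.
    by apply: lt_le_trans dim2; rewrite mulr_gt0// exprn_gt0// divr_gt0//; lra.
  have := halfspace_ge_global sigmaP h0 sz; rewrite -/B bE -EFinM lee_fin => hb.
  rewrite ler_pdivrMr//; apply: (@le_trans _ _ (2 * (2 * d.+1%:R * (2 / h + 1) ^+ d * b))).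
    by lra.
  rewrite mulrA mulrC ler_wpM2l//; apply: le_trans dim2; rewrite ler_wpM2l//.
  apply: (@le_trans _ _ (4 ^+ d * (7 * (n%:R * d%:R)) ^+ d)).
    have nd1 : 1 <= n%:R * d%:R :> R by rewrite mulr_ege1.
    have hE : 2 / h = 6 * (n%:R * d%:R) by rewrite /h invrK; ring.
    by rewrite hE ler_pM ?mulr_ge0 ?exprn_ge0 ?two_succ_le_exp4// ?lerXn2r ?nnegrE//; lra.
  rewrite -exprMn lerXn2r ?nnegrE ?divr_ge0 ?mulr_ge0// ler_pdivlMr ?(lt_le_trans ltr01)//.
  by move: nt; rewrite -(ler_nat R) 2!natrM natrX; lra.
have [MZf _] := MZt _ Pf; have [_ MZg] := MZt _ Pg.
have chain : ((a * (b / 2))%:E <=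
    mu (cap z r) + (q * (A * (2 * (100 * d%:R) ^+ d * b)))%:E)%E.
  rewrite EFinM; apply: le_trans (lee_wpmul2l _ lo) _; first by rewrite lee_fin ltW.
  apply: le_trans MZf _; apply: le_trans tailf _; rewrite leeD2l// EFinM.
  apply: lee_wpmul2l; first by rewrite lee_fin.
  apply: le_trans MZg _; rewrite EFinM lee_wpmul2l// lee_fin; lra.
(* By the choice of [kap], the error is the quantity of [tail_constant] times [(1 - eps) a b / 2]. A
   share [eps] of the main term survives. *)
have absorb : q * (A * (2 * (100 * d%:R) ^+ d * b)) <= (1 - eps) * (a * (b / 2)).
  have kapE (x y : R) : x * (A * (2 * y * b)) =
      kap * x * (4 * y) * ((1 - eps) * (a * (b / 2))).
    by rewrite /kap; field; rewrite !gt_eqF// subr_gt0.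
  rewrite kapE.
  by rewrite ler_piMl// !mulr_ge0//; lra.
have goal : ((a * (b / 2) - (1 - eps) * (a * (b / 2)))%:E <= mu (cap z r))%E.
  rewrite EFinB leeBlDr//; apply: le_trans chain _.
  by rewrite leeD2l// lee_fin.
apply: le_trans goal; rewrite lee_fin.
have -> : a * (b / 2) - (1 - eps) * (a * (b / 2)) = a * eps * (b / 2) by ring.
have : 1 / (dimPi d t)%:R <= b / 2 by lra.
by rewrite -[leLHS]/(1 * _) mul1r => hb; rewrite ler_wpM2l// mulr_ge0// ltW.
Qed.
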